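(* Let $\mathcal{C}$ be a geometrically griddable permutation class. Then there is a regular language $L$ over a finite alphabet and a length-preserving bijection $L\to\mathcal{C}$; and thus the generating function $\sum_{\pi\in\mathcal{C}}x^{|\pi|}$ of $\mathcal{C}$ is rational.
   Context: A permutation of length $n\ge 0$ is a bijection of $\{1,\dots,n\}$, written in one-line notation; $|\pi|$ denotes the length of $\pi$. A permutation $\pi$ of length $n$ contains a permutation $\sigma$ of length $k$ (written $\sigma\le\pi$) if $\pi$ has a subsequence of length $k$ that is order isomorphic to $\sigma$. A permutation class is a set of permutations that is downward closed under $\le$. A regular language is a set of finite words over a finite alphabet accepted by a deterministic finite state automaton; the length of a word is its number of letters. A map from words to permutations is length-preserving if it sends each word of length $n$ to a permutation of length $n$. Matrices are indexed first by column (left to right) and then by row (bottom to top); a $t\times u$ matrix has $t$ columns and $u$ rows. Let $M$ be a $t\times u$ matrix with entries in $\{0,1,-1\}$. The standard figure $\Lambda$ of $M$ is the subset of $\mathbb{R}^2$ consisting of the increasing open line segment from $(k-1,\ell-1)$ to $(k,\ell)$ for each $(k,\ell)$ with $M_{k,\ell}=1$, and the decreasing open line segment from $(k-1,\ell)$ to $(k,\ell-1)$ for each $(k,\ell)$ with $M_{k,\ell}=-1$. The geometric grid class $\operatorname{Geom}(M)$ is the set of all permutations obtained as follows: choose finitely many points of $\Lambda$, no two on a common horizontal or vertical line, label them $1,\dots,n$ from bottom to top, and read the labels from left to right. A permutation class is geometrically griddable if it is contained in $\operatorname{Geom}(M)$ for some matrix $M$ with entries in $\{0,1,-1\}$. 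*)

(* Defs.v *)
From mathcomp Require Import all_boot all_order all_algebra all_fingroup.
From mathcomp Require Import boolp classical_sets functions reals.

Set Implicit Arguments.
Unset Strict Implicit.
Unset Printing Implicit Defensive.

Import Order.TTheory GRing.Theory Num.Theory.

Local Open Scope classical_set_scope.
Local Open Scope ring_scope.

(** Positions and values are both numbered from 0, so that a permutation of
    length n is a bijection of {0, ..., n-1}. *)

Definition permutation : Type := {n : nat & 'S_n}.

Definition perm_of_length (n : nat) (s : 'S_n) : permutation :=
  existT (fun n => 'S_n) n s.

Definition perm_length (p : permutation) : nat := projT1 p.

Definition perm_entry (p : permutation) (i : 'I_(perm_length p)) : nat :=
  projT2 p i.

Definition perm_contains (p q : permutation) : Prop :=
  exists f : 'I_(perm_length q) -> 'I_(perm_length p),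
    (forall i j : 'I_(perm_length q), (i < j)%N -> (f i < f j)%N) /\
    (forall i j : 'I_(perm_length q),
       (perm_entry i < perm_entry j)%N =
       (perm_entry (f i) < perm_entry (f j))%N).

Definition permutation_class (C : set permutation) : Prop :=
  forall p q, C p -> perm_contains p q -> C q.

(** A gridding matrix M : 'M[int]_(t, u) is indexed first by column (left to
    right) and then by row (bottom to top): M k l is the entry of the k-th
    column and l-th row, both numbered from 0, and it governs the unit
    cell with corners (k, l) and (k + 1, l + 1). *)

Definition gridding_matrix (t u : nat) (M : 'M[int]_(t, u)) : Prop :=
  forall k l, M k l \in [:: 0; 1; -1].

Definition open_segment (R : realType) (a b : R * R) : set (R * R) :=
  [set z | exists2 c : R, 0 < c < 1 &
           z = ((1 - c) * a.1 + c * b.1, (1 - c) * a.2 + c * b.2)].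

Definition standard_figure (R : realType) (t u : nat) (M : 'M[int]_(t, u)) :
    set (R * R) :=
  [set z | exists (k : 'I_t) (l : 'I_u),
     (M k l = 1 /\ open_segment (k%:R, l%:R) (k.+1%:R, l.+1%:R) z) \/
     (M k l = -1 /\ open_segment (k%:R, l.+1%:R) (k.+1%:R, l%:R) z)].

(** The chosen points z 0, z 1, ... are listed from left to right, so that the
    i-th entry of the permutation is the label of z i, i.e., the number of
    chosen points that lie below z i (labels being numbered from 0). *)
Definition Geom (R : realType) (t u : nat) (M : 'M[int]_(t, u)) :
    set permutation :=
  [set p | exists z : 'I_(perm_length p) -> R * R,
     [/\ forall i, standard_figure M (z i),
         forall i j : 'I_(perm_length p), (i < j)%N -> (z i).1 < (z j).1,
         injective (fun i => (z i).2) &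
         forall i, perm_entry i = #|[pred j | (z j).2 < (z i).2]| ]].

Definition geometrically_griddable (R : realType) (C : set permutation) : Prop :=
  exists (t u : nat) (M : 'M[int]_(t, u)),
    gridding_matrix M /\ C `<=` Geom R M.

Record dfa (A : finType) := Dfa {
  dfa_state : finType;
  dfa_start : dfa_state;
  dfa_final : pred dfa_state;
  dfa_trans : dfa_state -> A -> dfa_state
}.

Definition dfa_accept (A : finType) (d : dfa A) (w : seq A) : bool :=
  dfa_final (foldl (@dfa_trans A d) (dfa_start d) w).

Definition regular (A : finType) (L : set (seq A)) : Prop :=
  exists d : dfa A, forall w, L w <-> dfa_accept d w.

(** A formal power series is identified with its coefficient sequence. *)

Definition fps : Type := nat -> rat.

Definition fps_of_poly (p : {poly rat}) : fps := fun n => p`_n.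

Definition fps_mul (f g : fps) : fps :=
  fun n => \sum_(i < n.+1) f i * g (n - i)%N.

(** f is P / Q, where Q is invertible as a power series. *)
Definition rational_fps (f : fps) : Prop :=
  exists P Q : {poly rat},
    Q`_0 != 0 /\ fps_mul (fps_of_poly Q) f =1 fps_of_poly P.

Definition generating_function (C : set permutation) : fps :=
  fun n => #|[pred s : 'S_n | `[< C (perm_of_length s) >]]|%:R.

(* Main.v *)
Require Import Defs.
From mathcomp Require Import all_boot all_order all_algebra all_fingroup.
From mathcomp Require Import boolp classical_sets functions reals.
From mathcomp Require Import cardinality zify ring lra.

(** A point of the standard figure is known up to order once its quarter cell and
    its distance to the centre of its unit cell are: in a half column the
    horizontal position is a monotone function of the distance, and likewise
    in a half row.  Hence, listing the quarter cells of the points by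
    increasing distance, a permutation of [Geom M] is encoded by a word over
    the finite alphabet of quarter cells ([Geom_word]), and subwords encode
    contained permutations.  The words encoding members of a class [C] therefore
    form a subword-closed language, and such languages are regular
    ([subseq_closed_recognizable]), by Higman's theorem: the residuals of
    a subword-closed language are subword-closed and can shrink only finitely
    often.

    Each member of [C] has several encodings, and a regular set of
    representatives must be selected.  Two sources of ambiguity are treated in
    turn.

    First, a permutation has several griddings, i.e. assignments of quarter
    cells to its points; the one whose sequence of cells from left to right is
    lexicographically least is preferred.  A pair of griddings of one
    permutation is a word over pairs of quarter cells, with the first gridding
    encoded as before and the second one as an additional label on each letter.
    These words also form a subword-closed, hence regular, language
    ([regriddable_subseq_closed]).  Whether the second gridding is better is
    decided at the leftmost disagreement of the labels, which is a regular
    condition.  Projecting to the first track and complementing leaves the words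
    whose gridding is preferred ([recognizable_improvable]).

    Second, words encode the same gridding exactly when they differ by exchanges
    of neighbouring letters that share neither column nor row.  This is
    equality in a partially commutative monoid, where lexicographically least
    representatives are the words without a factor [b u a] such that [a] is
    smaller than [b] and commutes with [b] and with [u] ([descents]).

    The words passing both tests form a regular language in bijection with [C]
    ([canonical_exists], [canonical_unique]).  Finally, the generating function
    of a regular language satisfies the linear recurrence given by the
    characteristic polynomial of the transfer matrix of an automaton
    ([dfa_count_rational]). *)

Set Implicit Arguments.
Unset Strict Implicit.
Unset Printing Implicit Defensive.

Import Order.TTheory GRing.Theory Num.Theory.

Local Open Scope classical_set_scope.
Local Open Scope nat_scope.

(** * Higman's theorem *)

Definition bad_sequence (A : eqType) (f : nat -> seq A) : Prop :=
  forall i j, i < j -> ~~ subseq (f i) (f j).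

(** The sequence is built greedily: having fixed its first [n] terms, the next
    one is a shortest word among those that still leave the finite prefix
    extendable to a bad sequence. *)
Lemma minimal_bad_sequence (A : eqType) (f : nat -> seq A) :
  bad_sequence f ->
  exists2 g : nat -> seq A, bad_sequence g &
    forall n g', bad_sequence g' -> (forall i, i < n -> g' i = g i) ->
                 size (g n) <= size (g' n).
Proof.
move=> bad_f.
pose extendable (s : seq (seq A)) :=
  exists2 g, bad_sequence g & forall i, i < size s -> g i = nth [::] s i.
have /choice [next nextP] (s : seq (seq A)) : exists w, extendable s ->
    extendable (rcons s w) /\
    forall w', extendable (rcons s w') -> size w <= size w'.
  have [[g bad_g gs]|] := pselect (extendable s); last by exists [::].
  have ex_size : exists n, `[< exists2 w, extendable (rcons s w) & size w = n >].
    exists (size (g (size s))); apply/asboolP; exists (g (size s)) => //.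
    exists g => // i; rewrite size_rcons ltnS nth_rcons leq_eqVlt.
    by case: ltngtP => //= [lt_is _|-> //]; apply: gs.
  case: (ex_minnP ex_size) => n /asboolP[w ext_w <-] min_w.
  by exists w => _; split=> // w' ext_w'; apply: min_w; apply/asboolP; exists w'.
pose pref n := iter n (fun s => rcons s (next s)) [::].
have size_pref n : size (pref n) = n by elim: n => //= n IH; rewrite size_rcons IH.
have ext_pref n : extendable (pref n).
  by elim: n => [|n /nextP[]//]; exists f.
pose g n := next (pref n).
have nth_pref n i : i < n -> nth [::] (pref n) i = g i.
  elim: n => //= n IH; rewrite ltnS nth_rcons size_pref leq_eqVlt.
  by case: ltngtP => //= [/IH|-> //].
exists g.
  move=> i j lt_ij; have [f' bad' eq_f'] := ext_pref j.+1.
  rewrite size_pref in eq_f'.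
  by rewrite -!(nth_pref j.+1) ?eq_f' ?ltnS // 1?ltnW // -!eq_f' ?bad' ?ltnS // ltnW.
move=> n g' bad' eq_g'; apply: (nextP _ (ext_pref n)).2.
exists g' => // i; rewrite size_rcons size_pref ltnS nth_rcons size_pref leq_eqVlt.
by case: ltngtP => //= [lt_in _|-> //]; rewrite nth_pref ?eq_g'.
Qed.

Lemma letter_infinitely_often (A : finType) (c : nat -> A) :
  exists a, forall N, exists2 n, N <= n & c n = a.
Proof.
apply: contrapT => /forallNP noa.
have /choice [N NP] a : exists N, forall n, N <= n -> c n != a.
  have /existsNP[N NP] := noa a; exists N => n leNn.
  by apply/eqP => ca; apply: NP; exists n.
pose m := \max_a N a.
by have := NP (c m) m (leq_bigmax _); rewrite eqxx.
Qed.

(** Nash-Williams' argument.  In a bad sequence [g] that is minimal in the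
    above sense, infinitely many terms begin with one letter [a].  Keep [g] up
    to the first of them, and from then on follow these terms with their [a]
    removed: the result is still bad, and shorter at the place of the first
    change. *)
Theorem higman (A : finType) (f : nat -> seq A) :
  exists i j, i < j /\ subseq (f i) (f j).
Proof.
apply: contrapT => no_good.
have {no_good} /minimal_bad_sequence [g bad_g min_g] : bad_sequence f.
  by move=> i j lt_ij; apply/negP => sub; apply: no_good; exists i, j.
have g_consE n : exists c : A * seq A, g n = c.1 :: c.2.
  have := bad_g n n.+1 (ltnSn n).
  by case: (g n) => [|a t]; [rewrite sub0seq|exists (a, t)].
have {g_consE} /choice [c g_cons] := g_consE.
have [a aP] := letter_infinitely_often (fst \o c).
have {aP} /choice [later laterP] N : exists n, N <= n /\ (c n).1 = a.
  by have [n] := aP N; exists n.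
pose e := fix e k := if k is k'.+1 then later (e k').+1 else later 0.
have e_head k : g (e k) = a :: (c (e k)).2.
  by rewrite g_cons; case: k => [|k] /=; rewrite (laterP _).2.
have e_mono : {homo e : i j / i < j}.
  by apply: homo_ltn => [? ? ?|k]; [exact: ltn_trans|exact: (laterP _).1].
pose g' n := if n < e 0 then g n else (c (e (n - e 0))).2.
have /min_g : bad_sequence g'.
  move=> i j lt_ij; rewrite /g'; case: (ltnP i (e 0)) => [lt_ie|le_ei].
    case: (ltnP j (e 0)) => [_|le_ej]; first exact: bad_g.
    (* a word embedded in the tail of [g (e k)] is embedded in [g (e k)] *)
    have lt_i : i < e (j - e 0).
      apply: leq_trans lt_ie _; case: (j - e 0) => // k.
      exact/ltnW/e_mono.
    apply: contra (bad_g _ _ lt_i) => sub.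
    by rewrite e_head; apply: subseq_trans sub (subseq_cons _ _).
  rewrite ltnNge (leq_trans le_ei (ltnW lt_ij)) /=.
  have := bad_g (e (i - e 0)) (e (j - e 0)); rewrite !e_head /= eqxx.
  by apply; apply: e_mono; rewrite ltn_sub2r // (leq_ltn_trans le_ei).
move=> /(_ (e 0)); rewrite {2}/g' ltnn subnn e_head /= ltnn => absurd.
by suff: false by []; apply: absurd => i lt_ie; rewrite /g' lt_ie.
Qed.

(** * Regular languages *)

(** Myhill-Nerode regularity, asking only for a map [h] of finite range whose
    fibres refine the syntactic right congruence; [h] itself need not be
    compatible with appending a letter.  This freedom keeps the closure
    properties below free of any automaton construction. *)
Definition recognizable (A : finType) (L : set (seq A)) : Prop :=
  exists (S : finType) (h : seq A -> S),
    forall u v z, h u = h v -> L (u ++ z) -> L (v ++ z).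

(** The states are the values of [h]; a letter is read from a state by appending
    it to a chosen representative of that state. *)
Lemma recognizable_regular (A : finType) (L : set (seq A)) :
  recognizable L -> regular L.
Proof.
move=> [S [h hP]].
have /choice [rep repP] s : exists u, forall v, h v = s -> h u = s.
  by have [[u us]|] := pselect (exists u, h u = s);
    [exists u|move=> no; exists [::] => v vs; case: no; exists v].
pose d := @Dfa A S (h [::]) (fun s => `[< L (rep s) >]) (fun s a => h (rcons (rep s) a)).
have run w u s : s = h u ->
    (L (u ++ w) <-> `[< L (rep (foldl (@dfa_trans A d) s w)) >]).
  elim: w u s => [|a w IH] u s ->; have repu := repP _ _ (erefl (h u)).
    rewrite cats0 /=; split=> [Lu|/asboolP Lr]; [apply/asboolP|].
      by rewrite -[rep _]cats0; apply: (hP u); rewrite ?cats0.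
    by rewrite -[u]cats0; apply: (hP (rep (h u))); rewrite ?cats0.
  rewrite /= -(IH (rcons (rep (h u)) a)) // cat_rcons.
  by split; apply: hP.
by exists d => w; rewrite -[w in L w]cat0s; apply: run.
Qed.

Lemma recognizableI (A : finType) (L1 L2 : set (seq A)) :
  recognizable L1 -> recognizable L2 -> recognizable (L1 `&` L2).
Proof.
move=> [S1 [h1 h1P]] [S2 [h2 h2P]].
exists (S1 * S2)%type, (fun w => (h1 w, h2 w)) => u v z [e1 e2] [uz1 uz2].
by split; [apply: h1P e1 uz1|apply: h2P e2 uz2].
Qed.

Lemma recognizableC (A : finType) (L : set (seq A)) :
  recognizable L -> recognizable (~` L).
Proof.
by move=> [S [h hP]]; exists S, h => u v z e nuz vz; apply: nuz; apply: hP vz.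
Qed.

(** The subset construction: [u] is remembered through the values of [h] on all
    its preimages under [f]. *)
Lemma recognizable_map_image (A B : finType) (f : A -> B) (L : set (seq A)) :
  recognizable L -> recognizable [set w | exists2 v, L v & map f v = w].
Proof.
move=> [S [h hP]].
exists {set S}, (fun w => [set s | `[< exists2 v, map f v = w & h v = s >]]%SET).
move=> u1 u2 z /setP eq_u /= [v Lv vE].
pose v1 := take (size u1) v; pose v2 := drop (size u1) v.
have v1E : map f v1 = u1 by rewrite map_take vE take_size_cat.
have v2E : map f v2 = z by rewrite map_drop vE drop_size_cat.
have := eq_u (h v1); rewrite !inE; have -> : `[< exists2 v, map f v = u1 & h v = h v1 >].
  by apply/asboolP; exists v1.
move=> /esym/asboolP [v1' v1'E hv1']; exists (v1' ++ v2); last by rewrite map_cat v1'E v2E.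
by apply: (hP v1); rewrite ?hv1' // cat_take_drop.
Qed.

Lemma recognizable_bigcup (I A : finType) (P : set I) (L : I -> set (seq A)) :
  (forall i, P i -> recognizable (L i)) -> recognizable (\bigcup_(i in P) L i).
Proof.
move=> recL.
have /choice [Sh hP] i : exists Sh : {S : finType & seq A -> S},
    P i -> forall u v z, projT2 Sh u = projT2 Sh v -> L i (u ++ z) -> L i (v ++ z).
  have [/recL [S [h hP]]|nPi] := pselect (P i).
    by exists (existT (fun S : finType => seq A -> S) S h).
  by exists (existT (fun S : finType => seq A -> S) unit (fun=> tt)).
exists {dffun forall i, projT1 (Sh i)}, (fun w => [ffun i => projT2 (Sh i) w]).
move=> u v z /ffunP eq_uv.
move=> [i Pi Luz]; exists i => //; apply: hP Luz => //.
by have := eq_uv i; rewrite !ffunE.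
Qed.

Lemma recognizable_all (A : finType) (P : pred A) : recognizable [set w | all P w].
Proof.
by exists bool, (all P) => u v z; rewrite /= !all_cat => ->.
Qed.

Lemma recognizable_letter (A : finType) (a : A) : recognizable [set [:: a]].
Proof.
exists (option bool), (fun w => if w is b :: w' then Some ((b == a) && nilp w') else None).
move=> [|b u] [|c v] z //= [E] [ba /nilP]; move: E; rewrite ba eqxx /=.
by rewrite cat_nilp => /esym + /andP[u0 /nilP ->]; rewrite u0 cats0 => /andP[/eqP -> /nilP ->].
Qed.

Definition cat_lang (A : Type) (L1 L2 : set (seq A)) : set (seq A) :=
  [set w | exists u v, [/\ w = u ++ v, L1 u & L2 v]].

(** Appending [z] to [u] creates a factorization whose cut falls either inside
    [u], where the remainder of [u] matters only up to [h2], or inside [z],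
    where [u] matters only up to [h1]. *)
Lemma recognizable_cat (A : finType) (L1 L2 : set (seq A)) :
  recognizable L1 -> recognizable L2 -> recognizable (cat_lang L1 L2).
Proof.
move=> [S1 [h1 h1P]] [S2 [h2 h2P]].
pose tails u := [set s | `[< exists u1 u2, [/\ u = u1 ++ u2, L1 u1 & h2 u2 = s] >]]%SET.
exists (S1 * {set S2})%type, (fun u => (h1 u, tails u)) => u v z [eq1 /setP eq2].
move=> [w1 [w2 [E L1w1 L2w2]]].
have [le_w1|lt_w1] := leqP (size w1) (size u).
  have uE : u = w1 ++ drop (size w1) u.
    by rewrite -[LHS](cat_take_drop (size w1)) -[in LHS](takel_cat z le_w1) E take_size_cat.
  have w2E : w2 = drop (size w1) u ++ z.
    by move/eqP: E; rewrite {1}uE -catA eqseq_cat // => /andP[_ /eqP].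
  have := eq2 (h2 (drop (size w1) u)); rewrite !inE.
  have -> : `[< exists u1 u2, [/\ u = u1 ++ u2, L1 u1 & h2 u2 = h2 (drop (size w1) u)] >].
    by apply/asboolP; exists w1, (drop (size w1) u).
  move=> /esym/asboolP [v1 [v2 [-> L1v1 e2]]].
  exists v1, (v2 ++ z); split=> //; first by rewrite catA.
  by apply: (h2P (drop (size w1) u)); rewrite -?w2E.
have w1E : w1 = u ++ drop (size u) w1.
  by rewrite -[LHS](cat_take_drop (size u)) -[in LHS](takel_cat w2 (ltnW lt_w1)) -E take_size_cat.
have zE : z = drop (size u) w1 ++ w2.
  by move/eqP: E; rewrite {1}w1E -catA eqseq_cat // => /andP[_ /eqP].
exists (v ++ drop (size u) w1), w2; split=> //; first by rewrite zE catA.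
by apply: h1P eq1 _; rewrite -w1E.
Qed.

Definition subseq_closed (A : eqType) (D : set (seq A)) : Prop :=
  forall u v, subseq u v -> D v -> D u.

Definition residual (A : Type) (D : set (seq A)) (u : seq A) : set (seq A) :=
  [set z | D (u ++ z)].

Lemma finite_residuals_recognizable (A : finType) (D : set (seq A)) :
  finite_set (range (residual D)) -> recognizable D.
Proof.
move=> /finite_seqP [s sE].
have in_s u : residual D u \in s.
  have : range (residual D) (residual D u) by exists u.
  by rewrite sE.
exists 'I_(size s).+1, (fun u => inord (index (residual D u) s)).
move=> u v z /(congr1 val); rewrite /= !inordK ?ltnS ?index_size //.
move=> eq_uv; suff eqr : residual D u = residual D v.
  by have := congr1 (fun E : set (seq A) => E z) eqr; rewrite /residual /= => ->.
by rewrite -(nth_index set0 (in_s u)) eq_uv nth_index.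
Qed.

(** Reading letters one by one, either the residual never changes, or it equals
    a residual of the first [residual D [:: a]] that differs from [D]. *)
Lemma finite_residuals_step (A : finType) (D : set (seq A)) :
  (forall a, residual D [:: a] <> D ->
             finite_set (range (residual (residual D [:: a])))) ->
  finite_set (range (residual D)).
Proof.
move=> finD; pose P a := residual D [:: a] <> D.
apply: (@sub_finite_set _ _ ([set D] `|`
   \bigcup_(a in [set a | P a]) range (residual (residual D [:: a])))).
  move=> _ [u _ <-]; elim: u => [|a u IH]; first by left; apply/seteqP; split.
  have [eqD|neD] := EM (residual D [:: a] = D).
    by have -> : residual D (a :: u) = residual D u by rewrite -[in RHS]eqD.
  by right; exists a => //; exists u.
rewrite finite_setU; split; first exact: finite_set1.
by apply: bigcup_finite => [|a /finD]; first exact: finite_finset.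
Qed.

(** A residual of a subword-closed language is a subword-closed subset of it.  If
    there were infinitely many residuals, the previous lemma would give
    a residual by one letter that is strictly smaller and still has infinitely
    many residuals, and so on forever.  Choosing in each language of this
    strictly decreasing chain a word that is missing from the next one
    contradicts Higman's theorem. *)
Theorem subseq_closed_recognizable (A : finType) (D : set (seq A)) :
  subseq_closed D -> recognizable D.
Proof.
move=> closedD; apply: finite_residuals_recognizable; apply: contrapT => infD.
pose large (E : set (seq A)) := subseq_closed E /\ ~ finite_set (range (residual E)).
have shrink (E : set (seq A)) : exists E', large E ->
    [/\ large E', E' `<=` E & exists2 w, E w & ~ E' w].
  have [[closedE infE]|] := EM (large E); last by exists E.
  have [a [neE inf_a]] : exists a, residual E [:: a] <> E /\
      ~ finite_set (range (residual (residual E [:: a]))).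
    apply: contrapT => /forallNP no; apply: infE; apply: finite_residuals_step.
    by move=> a neE; apply: contrapT => inf_a; apply: (no a).
  have subE : residual E [:: a] `<=` E.
    by move=> w; apply: closedE; apply: subseq_cons.
  exists (residual E [:: a]) => _; split=> //.
    by split=> // u v uv; apply: closedE; rewrite /= eqxx.
  apply: contrapT => no; apply: neE; apply/seteqP; split=> // w Ew.
  by apply: contrapT => nw; apply: no; exists w.
have {shrink} /choice [next nextP] := shrink.
pose chain n := iter n next D.
have chain_large n : large (chain n) by elim: n => //= n /nextP[].
have chain_sub i j : i <= j -> chain j `<=` chain i.
  elim: j => [|j IH]; first by rewrite leqn0 => /eqP ->.
  rewrite leq_eqVlt => /predU1P[->//|/IH]; apply: subset_trans.
  by have [] := nextP _ (chain_large j).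
have /choice [w wP] n : exists w, chain n w /\ ~ chain n.+1 w.
  by have [_ _ [w]] := nextP _ (chain_large n); exists w.
have [i [j [lt_ij sub]]] := higman w.
apply: (wP i).2; apply: (chain_large i.+1).1 sub _.
exact: chain_sub lt_ij _ (wP j).1.
Qed.

(** * Rational generating functions *)

(** The denominator is the polynomial of the recurrence with its coefficients
    reversed, so that the leading coefficient [c k] becomes the constant term. *)
Lemma linear_recurrence_rational (k : nat) (c : nat -> rat) (f : fps) :
  c k != 0%R ->
  (forall n, (\sum_(j < k.+1) c j * f (n + j)%N)%R = 0%R) ->
  rational_fps f.
Proof.
move=> ck_neq0 rec; pose Q := (\poly_(i < k.+1) c (k - i)%N)%R.
exists (\poly_(n < k) fps_mul (fps_of_poly Q) f n)%R, Q.
split=> [|n]; first by rewrite coef_poly subn0.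
rewrite /fps_of_poly [RHS]coef_poly; case: ltnP => // le_kn.
rewrite /fps_mul /fps_of_poly -(big_mkord predT (fun i => Q`_i * f (n - i)%N)%R).
rewrite (@big_cat_nat _ _ _ k.+1) ?ltnS //= [X in (_ + X)%R]big1_seq ?addr0; last first.
  move=> i /andP[_]; rewrite mem_index_iota => /andP[lt_ki _].
  by rewrite coef_poly ltnNge lt_ki mul0r.
rewrite big_nat_rev big_mkord -[RHS](rec (n - k)); apply: eq_bigr => j _.
have le_jk : j <= k by rewrite -ltnS.
rewrite add0n subSS coef_poly ltnS leq_subr subKn //.
by congr (_ * f _)%R; rewrite subnBA // addnC -addnBA // addnC.
Qed.

(** By Cayley-Hamilton the coefficients of the characteristic polynomial of [N]
    form a linear recurrence for the powers of [N]. *)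
Lemma matrix_powers_rational (m : nat) (N : 'M[rat]_m.+1) (u : 'rV_m.+1) (v : 'cV_m.+1) :
  rational_fps (fun n => (u *m (N ^+ n *m v)) ord0 ord0)%R.
Proof.
set p := char_poly N.
have sz_p : size p = m.+2 by rewrite size_char_poly.
apply: (@linear_recurrence_rational m.+1 (fun i => p`_i)%R).
  by rewrite -[m.+1]/(m.+2.-1) -sz_p -lead_coefE (monicP (char_poly_monic N)) oner_neq0.
move=> n.
transitivity ((u *m (N ^+ n * horner_mx N p *m v)) ord0 ord0)%R; last first.
  by rewrite Cayley_Hamilton mulr0 mul0mx mulmx0 mxE.
rewrite -[p in horner_mx N p]coefK poly_def sz_p raddf_sum /= mulr_sumr.
rewrite mulmx_suml mulmx_sumr summxE; apply: eq_bigr => j _.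
rewrite horner_mxZ rmorphXn /= horner_mx_X -scalerAr -exprD.
by rewrite -scalemxAl -scalemxAr [RHS]mxE.
Qed.

Lemma eq_rational_fps (f g : fps) : f =1 g -> rational_fps g -> rational_fps f.
Proof. by move=> /funext ->. Qed.

(** The number of accepted words is an entry of a power of the transfer matrix,
    whose [(i, j)] entry counts the letters leading from state [i] to state
    [j]. *)
Lemma dfa_count_rational (A : finType) (d : dfa A) :
  rational_fps (fun n => #|[pred w : n.-tuple A | dfa_accept d w]|%:R)%R.
Proof.
pose S := dfa_state d; pose m := #|S|.
(* one more index than states, which makes the type of matrices a ring; the
   extra row is harmless *)
pose code (q : S) : 'I_m.+1 := inord (enum_rank q).
pose decode (i : 'I_m.+1) : S := nth (dfa_start d) (enum S) i.
have codeK : cancel code decode.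
  move=> q; rewrite /decode /code inordK; first exact: nth_enum_rank.
  exact: ltnW (ltn_ord (enum_rank q)).
pose N : 'M[rat]_m.+1 :=
  (\matrix_(i, j) \sum_a (code (dfa_trans (decode i) a) == j)%:R)%R.
pose v : 'cV[rat]_m.+1 := (\col_i (dfa_final (decode i))%:R)%R.
pose count n q := (\sum_(w : n.-tuple A)
  (dfa_final (foldl (@dfa_trans A d) q w))%:R : rat)%R.
have countS n q : (count n.+1 q = \sum_a count n (dfa_trans q a))%R.
  rewrite /count pair_big /=.
  rewrite (reindex (fun x : A * n.-tuple A => [tuple of x.1 :: x.2])) //=.
  exists (fun w : n.+1.-tuple A => (thead w, [tuple of behead w])) => [[a w] _|w _] /=.
    by congr pair; apply: val_inj.
  by rewrite -tuple_eta.
have countE n q : (count n q = (N ^+ n *m v) (code q) ord0)%R.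
  elim: n q => [|n IH] q.
    rewrite expr0 mul1mx mxE codeK /count (big_pred1 [tuple]) // => w.
    by apply/esym/eqP; rewrite [w]tuple0; exact: val_inj.
  rewrite countS exprS -mulmxE -mulmxA mxE.
  under [RHS]eq_bigr => j _ do rewrite mxE codeK mulr_suml.
  rewrite [RHS]exchange_big /=; apply: eq_bigr => a _; rewrite IH.
  rewrite (bigD1 (code (dfa_trans q a))) //= eqxx mul1r big1 ?addr0 // => j.
  by rewrite eq_sym => /negPf ->; rewrite mul0r.
apply: (@eq_rational_fps _
  (fun n => (delta_mx 0 (code (dfa_start d)) *m (N ^+ n *m v)) ord0 ord0)%R) => [n|].
  rewrite [RHS]mxE (bigD1 (code (dfa_start d))) //= [X in (X * _)%R]mxE !eqxx mul1r.
  rewrite big1 ?addr0 => [|j /negPf jc]; last by rewrite mxE jc mul0r.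
  rewrite -countE /count -sum1_card natr_sum big_mkcond.
  by apply: eq_bigr => w _; rewrite inE -/(dfa_accept d w); case: dfa_accept.
exact: matrix_powers_rational.
Qed.

(** * Rankings of finite total orders *)

Definition strict_total_order (T : eqType) (lt : rel T) : Prop :=
  [/\ irreflexive lt, transitive lt & forall i j, i != j -> lt i j || lt j i].

Lemma card_ord_lt (n : nat) (i : 'I_n) : #|[pred j : 'I_n | j < i]| = i.
Proof.
rewrite -sum1_card (eq_bigl (fun j : 'I_n => j < i)) //.
by rewrite (big_ord_narrow (ltnW (ltn_ord i))) sum1_card card_ord.
Qed.

Lemma perm_rank (n : nat) (s : 'S_n) (i : 'I_n) :
  s i = #|[pred j | s j < s i]| :> nat.
Proof.
rewrite -[LHS]card_ord_lt -[RHS](fintype.card_image (@perm_inj _ s)).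
apply: eq_card => j; rewrite !inE; apply/idP/fintype.imageP => [lt_j|[k lt_k ->] //].
by exists (s^-1%g j); rewrite ?inE permKV.
Qed.

Lemma perm_eq_of_order (n : nat) (s t : 'S_n) :
  (forall i j, (s i < s j) = (t i < t j)) -> s = t.
Proof.
move=> st; apply/permP => i; apply: val_inj => /=.
by rewrite perm_rank [RHS]perm_rank; apply: eq_card => j; rewrite !inE st.
Qed.

Lemma ranking_exists (n : nat) (lt : rel 'I_n) :
  strict_total_order lt -> exists s : 'S_n, forall i j, lt i j = (s i < s j).
Proof.
move=> [irr tr tot]; pose r i := #|[pred j | lt j i]|.
have r_mono i j : lt i j -> r i < r j.
  move=> ltij; apply: proper_card; apply/properP; split.
    by apply/fintype.subsetP => k; rewrite !inE => /tr; apply.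
  by exists i; rewrite !inE ?irr.
have rE i j : lt i j = (r i < r j).
  apply/idP/idP => [/r_mono //|]; have [-> |/tot/orP[//|/r_mono lt_ji]] := eqVneq i j.
    by rewrite ltnn.
  by rewrite ltnNge ltnW.
have r_ord i : r i < n.
  rewrite -[n in _ < n]card_ord; apply: proper_card; apply/properP; split.
    exact: subset_predT.
  by exists i; rewrite !inE ?irr.
pose ro i := Ordinal (r_ord i).
have ro_inj : injective ro.
  move=> i j /(congr1 val) /= rij; apply/eqP; apply: contraT => /tot.
  by rewrite !rE rij ltnn.
by exists (perm ro_inj) => i j; rewrite !permE rE.
Qed.

(** * Words drawing permutations *)

(** Horizontal (or vertical) order of two points lying in the strips numbered
    [c] and [c'], placed there at the times [s] and [s'].  The points of a strip
    move away, as time goes by, from the border between the twin strips [2k] and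
    [2k + 1]: rightwards in odd strips and leftwards in even ones. *)
Definition line_lt (c s c' s' : nat) : bool :=
  (c < c') || (c == c') && (if odd c then s < s' else s' < s).

Definition before (I A : Type) (key : A -> nat) (l : I -> A) (time : I -> nat) : rel I :=
  fun i j => line_lt (key (l i)) (time i) (key (l j)) (time j).

Lemma before_strict_total (I : eqType) (A : Type) (key : A -> nat) (l : I -> A)
    (time : I -> nat) :
  injective time -> strict_total_order (before key l time).
Proof.
move=> time_inj; rewrite /before /line_lt; split.
- by move=> i; rewrite ltnn eqxx; case: odd; rewrite ltnn.
- move=> j i k /orP[lt1|/andP[/eqP e1 lt1]] /orP[lt2|/andP[/eqP e2 lt2]].
  + by rewrite (ltn_trans lt1 lt2).
  + by rewrite -e2 lt1.
  + by rewrite e1 lt2.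
  + rewrite e1 e2 eqxx orbC; move: lt1 lt2; rewrite e1 e2.
    by case: odd => h1 h2; rewrite ?(ltn_trans h1 h2) ?(ltn_trans h2 h1).
- move=> i j; rewrite -(inj_eq time_inj) neq_ltn => ne_ij.
  case: (ltngtP (key (l i)) (key (l j))) => //= ->.
  by case: odd; rewrite // orbC.
Qed.

Lemma strict_total_eq (T : eqType) (lt lt' : rel T) :
  strict_total_order lt -> strict_total_order lt' ->
  (forall i j, lt i j -> lt' i j) -> lt =2 lt'.
Proof.
move=> [irr tr tot] [irr' tr' tot'] sub i j; apply/idP/idP => [/sub //|lt'ij].
have [eij|/tot/orP[//|/sub lt'ji]] := eqVneq i j; first by rewrite eij irr' in lt'ij.
by have := tr' _ _ _ lt'ij lt'ji; rewrite irr'.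
Qed.

Section Words.
(* A letter stands for a cell, known through the column and the row, in the
   sense of [line_lt], that contain it. *)
Variables (A : finType) (col row : A -> nat).

Definition word_before (n : nat) (key : A -> nat) (w : n.-tuple A) : rel 'I_n :=
  before key (tnth w) (@nat_of_ord n).

Lemma word_before_strict_total (n : nat) (key : A -> nat) (w : n.-tuple A) :
  strict_total_order (word_before key w).
Proof. exact: before_strict_total (@ord_inj n). Qed.

Lemma ranking_inv_exists (n : nat) (key : A -> nat) (w : n.-tuple A) :
  exists s : 'S_n, forall i j : 'I_n, (i < j) = word_before key w (s i) (s j).
Proof.
have [s sP] := ranking_exists (word_before_strict_total key w).
by exists (s^-1)%g => i j; rewrite sP !permKV.
Qed.

(** The positions of the letters of [w], listed in increasing order of the points
    that these letters insert. *)
Definition arrangement (n : nat) (key : A -> nat) (w : n.-tuple A) : 'S_n :=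
  projT1 (cid (ranking_inv_exists key w)).

Lemma arrangementP n key (w : n.-tuple A) (i j : 'I_n) :
  (i < j) = word_before key w (arrangement key w i) (arrangement key w j).
Proof. exact: projT2 (cid (ranking_inv_exists key w)) i j. Qed.

Lemma arrangement_unique n key (w : n.-tuple A) (s : 'S_n) :
  (forall i j : 'I_n, (i < j) = word_before key w (s i) (s j)) -> arrangement key w = s.
Proof.
move=> sP; apply: invg_inj; apply: perm_eq_of_order => i j.
by rewrite (arrangementP key w) !permKV sP !permKV.
Qed.

(** The permutation drawn by [w], whose i-th letter puts a point into its cell at
    time [i]. *)
Definition word_perm (n : nat) (w : n.-tuple A) : 'S_n :=
  (arrangement col w * (arrangement row w)^-1)%g.

(** The cells of the points of [word_perm w], from left to right.  They determine
    [w] only up to exchanging neighbouring letters that share neither column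
    nor row. *)
Definition labels (n : nat) (w : n.-tuple A) (i : 'I_n) : A :=
  tnth w (arrangement col w i).

(** [l i] is the cell of the i-th point of [p] from the left, and [time i] the moment
    of its insertion.  Only the order of the times matters, but leaving them
    arbitrary makes the restriction of a gridding to fewer points immediate. *)
Definition gridding (n : nat) (p : 'S_n) (l : 'I_n -> A) (time : 'I_n -> nat) : Prop :=
  [/\ injective time,
      forall i j : 'I_n, (i < j) = before col l time i j &
      forall i j, (p i < p j) = before row l time i j].

Lemma word_gridding n (w : n.-tuple A) :
  gridding (word_perm w) (labels w) (fun i => arrangement col w i).
Proof.
split=> [i j /val_inj/perm_inj //|i j|i j]; first exact: arrangementP.
by rewrite !permM (arrangementP row w) !permKV.
Qed.

(** The word is obtained by sorting the labels by time. *)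
Lemma gridding_word n (p : 'S_n) l time : gridding p l time ->
  exists w : n.-tuple A,
    [/\ word_perm w = p, labels w =1 l &
        forall i j, (arrangement col w i < arrangement col w j) = (time i < time j)].
Proof.
move=> [time_inj colP rowP].
have [s sP] : exists s : 'S_n, forall i j, (time i < time j) = (s i < s j).
  apply: ranking_exists; split=> [i|i j k|i j]; first exact: ltnn.
    exact: ltn_trans.
  by rewrite -(inj_eq time_inj) neq_ltn.
pose w := [tuple l (s^-1%g i) | i < n].
have beforeE key i j : word_before key w (s i) (s j) = before key l time i j.
  by rewrite /word_before /before /line_lt !tnth_mktuple !permK !sP.
have arrE : arrangement col w = s.
  by apply: arrangement_unique => i j; rewrite beforeE.
have arrE' : arrangement row w = (p^-1 * s)%g.
  by apply: arrangement_unique => i j; rewrite !permM beforeE -rowP !permKV.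
exists w; split.
- by rewrite /word_perm arrE arrE' invMg invgK mulgA mulgV mul1g.
- by move=> i; rewrite /labels arrE tnth_mktuple permK.
- by move=> i j; rewrite arrE sP.
Qed.

Lemma word_perm_order n (w : n.-tuple A) i j :
  (word_perm w ((arrangement col w)^-1%g i) < word_perm w ((arrangement col w)^-1%g j)) =
  word_before row w i j.
Proof.
by have [_ _ ->] := word_gridding w; rewrite /before /labels !permKV.
Qed.

Definition perm_of_word (w : seq A) : permutation :=
  perm_of_length (word_perm (in_tuple w)).

(** Moves between a word seen as a tuple of its own size and as a tuple of a size
    to which its own one is only provably equal. *)
Lemma in_tuple_transfer (T : Type) (P : forall n, n.-tuple T -> Prop) n (w : n.-tuple T) :
  P _ (in_tuple w) <-> P n w.
Proof.
case: w => w sz_w; move: (sz_w); move/eqP: (sz_w) => En; subst n => sz.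
by have -> : Tuple sz = in_tuple w by apply: val_inj.
Qed.

Lemma perm_of_word_tuple n (w : n.-tuple A) :
  perm_of_word w = perm_of_length (word_perm w).
Proof.
by apply/(in_tuple_transfer (fun m v => perm_of_word w = perm_of_length (word_perm v))).
Qed.

Lemma perm_of_length_inj n : injective (@perm_of_length n).
Proof. by move=> s t; apply: eq_from_Tagged. Qed.

Lemma subseq_embedding (B : eqType) (u v : seq B) : subseq u v ->
  exists h : 'I_(size u) -> 'I_(size v),
    (forall i j, (h i < h j) = (i < j)) /\
    forall i, tnth (in_tuple v) (h i) = tnth (in_tuple u) i.
Proof.
have nat_embedding : subseq u v -> exists h : nat -> nat,
    {homo h : i j / i < j} /\
    forall i, i < size u -> h i < size v /\ forall x, nth x v (h i) = nth x u i.
  elim: v u => [|y v IH] [|x u] //=; try by exists id; split.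
  case: eqP => [-> /IH|_ /IH] [h [h_mono hP]].
    exists (fun i => if i is i'.+1 then (h i').+1 else 0); split.
      by move=> [|i] [|j] //; rewrite !ltnS => /h_mono.
    by move=> [|i] // /hP [? ?]; split.
  exists (S \o h); split=> [i j /h_mono //|i /hP[? ?]]; split=> //.
move=> /nat_embedding [h [h_mono hP]].
exists (fun i : 'I_(size u) => Ordinal (hP i (ltn_ord i)).1); split=> [i j /=|i].
  have [/h_mono -> //|lt_ji|->] := ltngtP i j; last by rewrite ltnn.
  by rewrite ltnNge ltnW // h_mono.
pose x := tnth (in_tuple u) i.
by rewrite !(tnth_nth x) /= (hP i (ltn_ord i)).2.
Qed.

Lemma word_before_embedding m n (u : m.-tuple A) (v : n.-tuple A) (h : 'I_m -> 'I_n) :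
  (forall i j, (h i < h j) = (i < j)) -> (forall i, tnth v (h i) = tnth u i) ->
  forall key i j, word_before key v (h i) (h j) = word_before key u i j.
Proof.
by move=> hm hl key i j; rewrite /word_before /before /line_lt !hl !hm.
Qed.

(** Omitting letters omits the corresponding points, since the relative order
    of two points depends on their letters and on the order of the latter
    only. *)
Lemma perm_of_word_subseq (u v : seq A) :
  subseq u v -> perm_contains (perm_of_word v) (perm_of_word u).
Proof.
move=> /subseq_embedding [h [hm hl]].
have bE := word_before_embedding hm hl.
pose su := arrangement col (in_tuple u); pose sv := arrangement col (in_tuple v).
exists (fun i => sv^-1%g (h (su i))); split.
  by move=> i j; rewrite /= (arrangementP col (in_tuple u)) (arrangementP col (in_tuple v)) !permKV bE.
move=> i j; rewrite /perm_entry /= word_perm_order bE -word_perm_order.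
by rewrite !permK.
Qed.

Lemma perm_class_words_subseq_closed (C : set permutation) :
  permutation_class C -> subseq_closed [set w | C (perm_of_word w)].
Proof. by move=> classC u v /perm_of_word_subseq sub Cv; apply: classC Cv sub. Qed.

(** The second components of [v] provide another gridding of the permutation that
    is drawn by the first components. *)
Definition regriddable (n : nat) (v : n.-tuple (A * A)) : Prop :=
  exists time : 'I_n -> nat,
    injective time /\
    forall key, key = col \/ key = row -> forall i j : 'I_n,
      word_before key (map_tuple fst v) i j = before key (fun k => (tnth v k).2) time i j.

(** Both griddings restrict to any subset of the points.  Thus, by Higman's
    theorem, a finite automaton checks that the second labelling is a gridding,
    although this means the existence of a suitable insertion order. *)
Lemma regriddable_subseq_closed :
  subseq_closed [set v : seq (A * A) | regriddable (in_tuple v)].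
Proof.
move=> u v /subseq_embedding [h [hm hl]] [time [time_inj timeP]].
exists (time \o h); split=> [i j /time_inj hij|key keyP i j].
  by have := hm i j; have := hm j i; rewrite hij !ltnn; case: ltngtP => // /ord_inj.
have := timeP key keyP (h i) (h j); rewrite /before /= !hl => <-.
symmetry; apply: word_before_embedding => // k.
by rewrite !tnth_map hl.
Qed.

Lemma regriddable_word n (v : n.-tuple (A * A)) (w := map_tuple fst v) :
  regriddable v ->
  exists2 w' : n.-tuple A, word_perm w' = word_perm w &
    forall i, labels w' i = (tnth v (arrangement col w i)).2.
Proof.
move=> [time [time_inj timeP]]; pose s := arrangement col w.
have [|w' [w'p w'l _]] := @gridding_word n (word_perm w)
    (fun i => (tnth v (s i)).2) (time \o s).
  split=> [i j /time_inj/perm_inj //|i j|i j].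
    by rewrite (arrangementP col w) (timeP _ (or_introl erefl)).
  rewrite -[i](permK s) -[j](permK s) word_perm_order.
  by rewrite (timeP _ (or_intror erefl)) /before /= !permK.
by exists w'.
Qed.

End Words.

(** * Normal forms of traces *)

Lemma all_segmentP (T : Type) n (w : n.-tuple T) (P : pred T) a b :
  reflect (forall j : 'I_n, a <= j < b -> P (tnth w j)) (all P (take (b - a) (drop a w))).
Proof.
case: n w => [|n] w.
  by rewrite tuple0 /=; left=> -[].
pose x := tnth w ord0.
apply: (iffP (all_nthP x)) => [allP j /andP[aj jb]|allP i].
  have := allP (j - a); rewrite size_take_min size_drop size_tuple nth_take ?nth_drop; last by lia.
  by rewrite subnKC // -tnth_nth; apply; have := ltn_ord j; lia.
rewrite size_take_min size_drop size_tuple => lt_i.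
have lt_n : a + i < n.+1 by lia.
rewrite nth_take ?nth_drop; last by lia.
by have := allP (Ordinal lt_n); rewrite (tnth_nth x) /=; apply; lia.
Qed.

Lemma drop_tnth (T : Type) n (w : n.-tuple T) (i : 'I_n) :
  drop i w = tnth w i :: drop i.+1 w.
Proof. by rewrite (tnth_nth (tnth w i)) -drop_nth ?size_tuple. Qed.

Lemma recognizable_setT (B : finType) : recognizable [set: seq B].
Proof. by exists unit, (fun=> tt). Qed.

Section Descents.
Variables (A : finType) (rk : A -> nat) (indep : rel A).

(** Words [p ++ b :: u ++ a :: s] in which [a] is smaller than [b] and can be moved
    in front of [b], being independent of [b] and of all letters of [u]: those
    that a move inside their trace makes lexicographically smaller. *)
Definition descents : set (seq A) :=
  \bigcup_(x in [set x : A * A | rk x.1 < rk x.2 /\ indep x.1 x.2])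
    cat_lang setT (cat_lang [set [:: x.2]] (cat_lang [set u | all (indep x.1) u]
      (cat_lang [set [:: x.1]] setT))).

Lemma recognizable_descents : recognizable descents.
Proof.
apply: recognizable_bigcup => x _.
apply: recognizable_cat; first exact: recognizable_setT.
apply: recognizable_cat; first exact: recognizable_letter.
apply: recognizable_cat; first exact: recognizable_all.
apply: recognizable_cat; first exact: recognizable_letter.
exact: recognizable_setT.
Qed.

Lemma descentsP n (w : n.-tuple A) :
  descents w <-> exists k m : 'I_n, [/\ k < m, rk (tnth w m) < rk (tnth w k) &
    forall j : 'I_n, k <= j < m -> indep (tnth w m) (tnth w j)].
Proof.
split.
  move=> [[a b] /= [lt_ab ind_ab] [p [q [wE _]]]].
  move=> [b' [q' [qE b'E [u [q'' [q'E all_u [a' [s [q''E a'E _]]]]]]]]].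
  rewrite {}qE {}q'E {}q''E [b']b'E [a']a'E /= in wE all_u.
  have sz : size p + (size u).+1 + size s < n.
    by rewrite -(size_tuple w) wE !size_cat /= size_cat /=; lia.
  have ltk : size p < n by lia.
  have ltm : size p + (size u).+1 < n by lia.
  have nthE (j : 'I_n) : tnth w j = nth a (p ++ b :: u ++ a :: s) j by rewrite (tnth_nth a) wE.
  exists (Ordinal ltk), (Ordinal ltm).
  have mE : tnth w (Ordinal ltm) = a.
    by rewrite nthE nth_cat /= ltnNge leq_addr /= addKn /= nth_cat ltnn subnn.
  rewrite mE; split=> /=; first by lia.
    by rewrite nthE nth_cat /= ltnn subnn.
  move=> j /andP[le_j lt_j]; rewrite nthE nth_cat ltnNge le_j /=.
  case E : (j - size p) => [|i] //=.
  have lt_i : i < size u by lia.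
  by rewrite nth_cat lt_i; apply: (all_nthP a all_u).
move=> [k [m [lt_km lt_rk all_ind]]].
exists (tnth w m, tnth w k); first by split=> //; apply: all_ind; rewrite leqnn.
exists (take k w), (drop k w); split=> //; first by rewrite cat_take_drop.
exists [:: tnth w k], (drop k.+1 w); split=> //; first exact: drop_tnth.
exists (take (m - k.+1) (drop k.+1 w)), (drop m w); split=> /=.
- by rewrite -[LHS](cat_take_drop (m - k.+1)) drop_drop subnK.
- by apply/all_segmentP => j /andP[/ltnW kj jm]; apply: all_ind; rewrite kj.
- by exists [:: tnth w m], (drop m.+1 w); split=> //; exact: drop_tnth.
Qed.

(** Equality in the partially commutative monoid, expressed by the bijection
    between positions that repeated exchanges of neighbouring independent
    letters would produce. *)
Definition trace_equivalent n (w1 w2 : n.-tuple A) : Prop :=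
  exists s : 'S_n, (forall i, tnth w2 (s i) = tnth w1 i) /\
    forall i j : 'I_n, ~~ indep (tnth w1 i) (tnth w1 j) -> (s i < s j) = (i < j).

Lemma trace_equivalent_sym n (w1 w2 : n.-tuple A) :
  trace_equivalent w1 w2 -> trace_equivalent w2 w1.
Proof.
move=> [s [sw so]]; exists (s^-1)%g.
have sw' i : tnth w1 (s^-1%g i) = tnth w2 i by rewrite -sw permKV.
by split=> // i j; rewrite -!sw' => /so <-; rewrite !permKV.
Qed.

(** The letter [tnth w2 k] comes from a position [m > k] of [w1].  Every letter of
    [w1] between [k] and [m] occurs in [w2] after position [k], hence was
    overtaken, so it is independent of that letter. *)
Lemma trace_equivalent_descents n (w1 w2 : n.-tuple A) (k : 'I_n) :
  irreflexive indep -> trace_equivalent w1 w2 ->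
  (forall j : 'I_n, j < k -> tnth w1 j = tnth w2 j) ->
  rk (tnth w2 k) < rk (tnth w1 k) -> descents w1.
Proof.
move=> indepF [s [sw so]] eq_lt lt_rk; apply/descentsP.
have s_fix (j : 'I_n) : j < k -> s j = j.
  move: {2}(nat_of_ord j) (erefl (nat_of_ord j)) => x; elim/ltn_ind: x j => x IH j jx jk.
  (* equal letters are dependent, so [s] preserves the order of their
     occurrences, and the common prefix leaves no room for moving *)
  have [m smj] : exists m, s m = j by exists (s^-1 j)%g; rewrite permKV.
  have m_ge : j <= m.
    rewrite leqNgt; apply/negP => lt_mj.
    have := IH m _ _ (erefl _) (ltn_trans lt_mj jk); rewrite -jx lt_mj => /(_ isT).
    by rewrite smj => E; rewrite -E ltnn in lt_mj.
  have := so j m; rewrite -sw -(sw m) smj.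
  have [eq_jm _|ne_jm] := eqVneq j m; first by rewrite {1}eq_jm.
  have -> : tnth w2 (s j) = tnth w2 j by rewrite sw eq_lt.
  rewrite indepF => /(_ isT); rewrite [RHS]ltn_neqAle ne_jm m_ge => lt_sj.
  have := IH (s j) _ (s j) (erefl _) (ltn_trans lt_sj jk).
  rewrite -jx lt_sj => /(_ isT) /perm_inj E; by rewrite E ltnn in lt_sj.
have [m sm] : exists m, s m = k by exists (s^-1 k)%g; rewrite permKV.
have km : k < m.
  rewrite ltn_neqAle leqNgt; apply/andP; split; last first.
    by apply/negP => lt_mk; have := s_fix _ lt_mk; rewrite sm => E; rewrite -E ltnn in lt_mk.
  by apply/eqP => /val_inj E; move: (sw m) lt_rk; rewrite sm -E => ->; rewrite ltnn.
exists k, m; split=> //; first by rewrite -sw sm.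
move=> j /andP[kj jm]; apply: contraT => dep.
have := so _ _ dep; rewrite sm [RHS]ltnNge (ltnW jm) /= ltnNge => /negbFE le_sj.
have sjk : s j < k.
  by rewrite ltn_neqAle le_sj -sm andbT; apply/eqP => /val_inj/perm_inj E; rewrite E ltnn in jm.
by have := s_fix _ sjk => /perm_inj E; rewrite E ltnNge kj in sjk.
Qed.

Lemma no_descents_unique n (w1 w2 : n.-tuple A) :
  injective rk -> irreflexive indep -> trace_equivalent w1 w2 ->
  ~ descents w1 -> ~ descents w2 -> w1 = w2.
Proof.
move=> rk_inj indepF eqv nd1 nd2; apply/eq_from_tnth.
suff eq_x (x : nat) : forall i : 'I_n, (i < x)%N -> tnth w1 i = tnth w2 i.
  by move=> i; exact: (eq_x i.+1 i (ltnSn i)).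
elim: x => // x IH i; rewrite ltnS leq_eqVlt => /predU1P[ix|/IH //].
rewrite -ix in IH; apply: rk_inj; apply/eqP; case: ltngtP => // lt_rk; exfalso.
  apply: nd2; apply: trace_equivalent_descents (trace_equivalent_sym eqv) _ lt_rk => //.
  by move=> j /IH ->.
by apply: nd1; apply: trace_equivalent_descents eqv _ lt_rk.
Qed.

End Descents.

(** * Canonical words *)

Lemma line_lt_time c s c' s' t t' :
  (s < s') = (t < t') -> (s' < s) = (t' < t) -> line_lt c s c' s' = line_lt c t c' t'.
Proof. by rewrite /line_lt => -> ->. Qed.

Section Canonical.
Variables (A : finType) (col row : A -> nat).

Let rk (a : A) : nat := enum_rank a.

Definition independent : rel A :=
  fun a b => (col a != col b) && (row a != row b).

Lemma independent_irreflexive : irreflexive independent.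
Proof. by move=> a; rewrite /independent eqxx. Qed.

Lemma rk_inj : injective rk.
Proof. by move=> a b /val_inj/enum_rank_inj. Qed.

Definition label_key n (w : n.-tuple A) : n.-tuplelexi nat :=
  [tuple rk (labels col w i) | i < n].

Definition letter_key n (w : n.-tuple A) : n.-tuplelexi nat :=
  [tuple rk (tnth w i) | i < n].

(** The leftmost point at which the two labels disagree is at a letter [x], where
    the second label is the smaller one.  Being to the left of that point is
    decided by the letter and by the side of [x] on which it lies in the word:
    the numbers 0 and 1 are mock times for before and after. *)
Definition improvements : set (seq (A * A)) :=
  \bigcup_(x in [set x : A * A | rk x.2 < rk x.1])
    cat_lang [set u | all (fun y => line_lt (col y.1) 0 (col x.1) 1 ==> (y.1 == y.2)) u]
      (cat_lang [set [:: x]]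
        [set u | all (fun y => line_lt (col y.1) 1 (col x.1) 0 ==> (y.1 == y.2)) u]).

Lemma recognizable_improvements : recognizable improvements.
Proof.
apply: recognizable_bigcup => x _.
apply: recognizable_cat; first exact: recognizable_all.
apply: recognizable_cat; [exact: recognizable_letter|exact: recognizable_all].
Qed.

Lemma improvementsP n (v : n.-tuple (A * A)) :
  improvements v <-> exists i : 'I_n, rk (tnth v i).2 < rk (tnth v i).1 /\
    forall j, word_before col (map_tuple fst v) j i -> (tnth v j).1 = (tnth v j).2.
Proof.
have beforeE (j i : 'I_n) : word_before col (map_tuple fst v) j i =
    line_lt (col (tnth v j).1) j (col (tnth v i).1) i.
  by rewrite /word_before /before !tnth_map.
split.
  move=> [x lt_x [u [q [vE all_u [x' [u' [qE x'E all_u']]]]]]].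
  rewrite {}qE [x']x'E /= in vE all_u all_u'.
  have sz : size u + (size u').+1 = n by rewrite -(size_tuple v) vE size_cat.
  have lt_i : size u < n by lia.
  have iE : tnth v (Ordinal lt_i) = x by rewrite (tnth_nth x) vE nth_cat /= ltnn subnn.
  exists (Ordinal lt_i); rewrite iE; split=> // j; rewrite beforeE iE /=.
  have jE : tnth v j = nth x (u ++ x :: u') j by rewrite (tnth_nth x) vE.
  rewrite jE nth_cat; case: (ltngtP j (size u)) => [lt_j|lt_j|->].
  - move=> b; apply/eqP; apply: (implyP (all_nthP x all_u _ lt_j)).
    by move: b; rewrite (@line_lt_time _ j _ (size u) 0 1) //; lia.
  - have [k kE] : exists k, j - size u = k.+1 by exists (j - size u).-1; lia.
    have lt_k : k < size u' by have := ltn_ord j; lia.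
    rewrite kE /= => b; apply/eqP; apply: (implyP (all_nthP x all_u' _ lt_k)).
    by move: b; rewrite (@line_lt_time _ j _ (size u) 1 0) //; lia.
  - by rewrite subnn /= /line_lt ltnn; case: odd; rewrite ltnn andbF.
move=> [i [lt_i agree]]; exists (tnth v i) => //.
exists (take i v), (drop i v); split; first by rewrite cat_take_drop.
  apply/allP => y /(nthP (tnth v i)) [j]; rewrite size_take_min size_tuple => lt_j <-.
  have lt_jn : j < n by have := ltn_ord i; lia.
  rewrite nth_take; last by lia.
  rewrite -[nth _ _ _](tnth_nth _ v (Ordinal lt_jn)); apply/implyP => b.
  apply/eqP/agree; rewrite beforeE (@line_lt_time _ _ _ _ 0 1) //=; lia.
exists [:: tnth v i], (drop i.+1 v); split=> //; first exact: drop_tnth.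
apply/allP => y /(nthP (tnth v i)) [j]; rewrite size_drop size_tuple => lt_j <-.
have lt_jn : i.+1 + j < n by lia.
rewrite nth_drop -[nth _ _ _](tnth_nth _ v (Ordinal lt_jn)); apply/implyP => b.
by apply/eqP/agree; rewrite beforeE (@line_lt_time _ _ _ _ 1 0) //=; lia.
Qed.

(** Words whose permutation has another gridding, with a lexicographically
    smaller sequence of labels from left to right.  The competing gridding is
    guessed: it is the second track of [v]. *)
Definition improvable : set (seq A) :=
  [set w | exists2 v, ([set v | regriddable col row (in_tuple v)] `&` improvements) v &
                      map fst v = w].

Lemma recognizable_improvable : recognizable improvable.
Proof.
apply: recognizable_map_image; apply: recognizableI recognizable_improvements.
exact/subseq_closed_recognizable/regriddable_subseq_closed.
Qed.

Lemma improvableP n (w : n.-tuple A) :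
  improvable w <-> exists2 w' : n.-tuple A,
    word_perm col row w' = word_perm col row w & (label_key w' < label_key w)%O.
Proof.
split=> [[v0 [reg imp] vE]|[w' w'p /ltxi_tuplePlt [k eq_lt lt_k]]].
  have sz : size v0 == n by rewrite -(size_tuple w) -vE size_map.
  pose v := Tuple sz; have {}vE : map_tuple fst v = w by apply: val_inj.
  have {}reg : regriddable col row v.
    exact: (in_tuple_transfer (fun m u => @regriddable A col row m u) v).1.
  have [w' w'p w'l] := regriddable_word reg.
  have /improvementsP [i [lt_i agree]] : improvements v := imp.
  rewrite vE in w'p w'l agree.
  exists w' => //; apply/ltxi_tuplePlt.
  have wl j : labels col w j = (tnth v (arrangement col w j)).1.
    by rewrite /labels -{1}vE tnth_map.
  exists ((arrangement col w)^-1 i)%g => [j lt_j|]; rewrite !tnth_mktuple w'l wl.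
    by rewrite agree //; move: lt_j; rewrite (arrangementP col w) permKV.
  by rewrite permKV.
rewrite !tnth_mktuple in lt_k.
pose s := arrangement col w; pose s' := arrangement col w'.
pose v := [tuple (tnth w i, labels col w' (s^-1 i)%g) | i < n].
have vE : map_tuple fst v = w by apply: eq_from_tnth => i; rewrite tnth_map tnth_mktuple.
exists v; last by rewrite -[RHS]/(tval w) -vE.
split.
  apply: (in_tuple_transfer (fun m u => @regriddable A col row m u) v).2.
  exists (fun i => nat_of_ord (s' (s^-1 i)%g)); split=> [i j /val_inj/perm_inj/perm_inj //|].
  rewrite vE => key keyP i j.
  have -> : before key (fun h => (tnth v h).2) (fun h => nat_of_ord (s' (s^-1 h)%g)) i j =
      word_before key w' (s' (s^-1 i)%g) (s' (s^-1 j)%g).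
    by rewrite /word_before /before !tnth_mktuple.
  case: keyP => ->; first by rewrite -!arrangementP (arrangementP col w) !permKV.
  by rewrite -!(word_perm_order col row) w'p !permK.
apply/improvementsP; exists (s k); rewrite tnth_mktuple /= permK; split=> // j.
rewrite vE tnth_mktuple /= -[j](permKV s) -arrangementP permK => /eq_lt.
by rewrite !tnth_mktuple => /rk_inj.
Qed.

(** In a descent, the point of the smaller letter can be inserted earlier, just
    before that of the larger one.  This changes no order between dependent
    letters, and it makes the word itself smaller. *)
Lemma descents_letter_key n (w : n.-tuple A) :
  descents rk independent w ->
  exists w' : n.-tuple A, [/\ word_perm col row w' = word_perm col row w,
    label_key w' = label_key w & (letter_key w' < letter_key w)%O].
Proof.
move=> /descentsP [k [m [lt_km lt_rk ind]]].
(* the slot [2k] precedes the slot [2k + 1] of position [k] *)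
pose time (i : 'I_n) := if i == m then k.*2 else i.*2.+1.
have time_inj : injective time.
  by move=> i j; rewrite /time; case: eqP => [->|_]; case: eqP => [->|_] // E; [lia|lia|apply: ord_inj; lia].
have beforeE key : key = col \/ key = row -> forall i j,
    before key (tnth w) time i j = word_before key w i j.
  move=> keyP i j; rewrite /word_before /before.
  have [eq_key|ne_key] := eqVneq (key (tnth w i)) (key (tnth w j)); last first.
    by rewrite /line_lt (negPf ne_key).
  have dep (x y : 'I_n) : key (tnth w x) = key (tnth w y) -> ~~ independent (tnth w x) (tnth w y).
    by rewrite /independent; case: keyP => -> ->; rewrite eqxx ?andbF.
  have timeP (y : 'I_n) : key (tnth w m) = key (tnth w y) -> (y < k) || (m <= y).
    move=> /dep; apply: contraR; rewrite negb_or -leqNgt -ltnNge => /ind //.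
  have neq (y : 'I_n) : y != m -> y <> m :> nat by move=> /eqP ne_y /ord_inj.
  apply: line_lt_time; rewrite /time; case: (eqVneq i m) eq_key => [->|im] eq_key;
    case: (eqVneq j m) eq_key => [->|jm] eq_key; rewrite ?ltnn //; try by lia.
  - by have := timeP _ eq_key; have := neq _ jm; lia.
  - by have := timeP _ (esym eq_key); have := neq _ im; lia.
  - by have := timeP _ eq_key; have := neq _ jm; lia.
  - by have := timeP _ (esym eq_key); have := neq _ im; lia.
pose s := arrangement col w.
have [|w' [w'p w'l w's]] := @gridding_word _ col row n (word_perm col row w) (labels col w) (time \o s).
  have [_ colP rowP] := word_gridding col row w.
  split=> [i j /time_inj/perm_inj //|i j|i j].
    by rewrite [LHS]colP -[LHS]beforeE //; left.
  by rewrite [LHS]rowP -[LHS]beforeE //; right.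
exists w'; split=> //; first by apply: eq_from_tnth => i; rewrite !tnth_mktuple w'l.
(* [t] sends each position of [w] to that of the same point in [w'] *)
pose t := (s^-1 * arrangement col w')%g.
have t_mono i j : (t i < t j) = (time i < time j).
  by rewrite !permM w's /= !permKV.
have t_letter i : tnth w' (t i) = tnth w i.
  by rewrite permM -[LHS]/(labels col w' (s^-1 i)%g) w'l /labels permKV.
have t_fix (i : 'I_n) : i < k -> t i = i.
  move=> lt_ik; apply: ord_inj; rewrite perm_rank -[RHS]card_ord_lt.
  have timeE : time i = i.*2.+1.
    by rewrite /time; case: eqVneq => // im; move: lt_ik; rewrite im; lia.
  by apply: eq_card => j; rewrite !inE t_mono timeE /time; case: (eqVneq j m) => [->|_]; lia.
have t_m : t m = k.
  apply: ord_inj; rewrite perm_rank -[RHS]card_ord_lt.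
  by apply: eq_card => j; rewrite !inE t_mono /time eqxx; case: (eqVneq j m) => [->|_]; lia.
apply/ltxi_tuplePlt; exists k => [i lt_ik|]; rewrite !tnth_mktuple.
  by rewrite -[in LHS](t_fix i lt_ik) t_letter.
by rewrite -[in X in (X < _)%O]t_m t_letter.
Qed.

(** The words that are kept: their gridding has the least sequence of labels
    among all griddings of the permutation, and they are in normal form among
    the words of that gridding. *)
Definition canonical : set (seq A) := ~` improvable `&` ~` descents rk independent.

Lemma recognizable_canonical : recognizable canonical.
Proof.
apply: recognizableI; apply: recognizableC; first exact: recognizable_improvable.
exact: recognizable_descents.
Qed.

Lemma canonical_exists n (w0 : n.-tuple A) :
  exists2 w : n.-tuple A, canonical w & word_perm col row w = word_perm col row w0.
Proof.
pose p := word_perm col row w0.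
case: (@arg_minP _ _ _ w0 (fun w => word_perm col row w == p) (@label_key n) (eqxx _)).
move=> w1 w1p w1_min.
have w1P : (word_perm col row w1 == p) && (label_key w1 == label_key w1) by rewrite w1p eqxx.
case: (@arg_minP _ _ _ w1 (fun w => (word_perm col row w == p) && (label_key w == label_key w1))
  (@letter_key n) w1P) => w /andP[/eqP wp /eqP wl] w_min.
exists w => //; split.
  move=> /improvableP [w' w'p]; rewrite wl ltNge => /negP; apply.
  by apply: w1_min; rewrite w'p wp.
move=> /descents_letter_key [w' [w'p w'l]]; rewrite ltNge => /negP; apply.
by apply: w_min; rewrite w'p w'l wp wl !eqxx.
Qed.

(** Two letters sharing a column (or a row) draw points whose horizontal (or
    vertical) order reveals the order of the letters. *)
Lemma word_perm_trace_equivalent n (w1 w2 : n.-tuple A) :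
  word_perm col row w1 = word_perm col row w2 -> label_key w1 = label_key w2 ->
  trace_equivalent independent w1 w2.
Proof.
move=> eqp eql; pose s1 := arrangement col w1; pose s2 := arrangement col w2.
have lE i : labels col w2 i = labels col w1 i.
  by apply: rk_inj; have := congr1 (fun u => tnth u i) eql; rewrite !tnth_mktuple.
exists (s1^-1 * s2)%g.
have sE i : tnth w2 ((s1^-1 * s2)%g i) = tnth w1 i.
  by rewrite permM -[LHS]/(labels col w2 (s1^-1 i)%g) lE /labels permKV.
split=> // i j dep.
have colE : word_before col w2 ((s1^-1 * s2)%g i) ((s1^-1 * s2)%g j) = word_before col w1 i j.
  by rewrite !permM -arrangementP (arrangementP col w1) !permKV.
have rowE : word_before row w2 ((s1^-1 * s2)%g i) ((s1^-1 * s2)%g j) = word_before row w1 i j.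
  have tE h : (s2^-1)%g ((s1^-1 * s2)%g h) = (s1^-1)%g h by rewrite permM permK.
  by rewrite -!(word_perm_order col row) !tE eqp.
have [-> |ne_ij] := eqVneq i j; first by rewrite !ltnn.
have ne_s : (s1^-1 * s2)%g i != (s1^-1 * s2)%g j by rewrite (inj_eq perm_inj).
move: dep colE rowE; rewrite /independent negb_and !negbK.
rewrite /word_before /before !sE /line_lt.
move=> /orP[] /eqP -> E1 E2; [move: E1|move: E2]; rewrite ltnn eqxx /=;
  case: odd => //; move: ne_ij ne_s; rewrite -!val_eqE /=; lia.
Qed.

Lemma canonical_unique n (w1 w2 : n.-tuple A) :
  canonical w1 -> canonical w2 -> word_perm col row w1 = word_perm col row w2 -> w1 = w2.
Proof.
move=> [ni1 nd1] [ni2 nd2] eqp; case: (ltgtP (label_key w1) (label_key w2)) => eql.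
- by case: ni2; apply/improvableP; exists w1.
- by case: ni1; apply/improvableP; exists w2.
- apply: no_descents_unique nd1 nd2; first exact: rk_inj.
    exact: independent_irreflexive.
  exact: word_perm_trace_equivalent.
Qed.

End Canonical.

(** * Points of the standard figure *)

Local Open Scope ring_scope.

(** Every unit column and row is cut in the middle, the boolean telling the
    right or upper half.  In each resulting quarter cell the figure is a segment that ends at
    the centre of the unit cell, or is empty.  The points of a half column thus
    move away from the midline as their distance to it grows, whatever the
    quarter, which is what [line_lt] describes: left and lower halves
    get even numbers, right and upper halves odd ones. *)
Definition quarter_cell (t u : nat) : finType := (('I_t * bool) * ('I_u * bool))%type.

Definition half_column (t u : nat) (a : quarter_cell t u) : nat := (a.1.1.*2 + a.1.2)%N.
Definition half_row (t u : nat) (a : quarter_cell t u) : nat := (a.2.1.*2 + a.2.2)%N.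

(** On a diagonal of a unit cell the two coordinates are at the same distance from
    the centre; this common distance will serve as a time. *)
Lemma standard_figure_coordinates (R : realType) t u (M : 'M[int]_(t, u)) (z : R * R) :
  standard_figure M z ->
  exists (k : 'I_t) (l : 'I_u) (c d : R),
    [/\ z.1 = k%:R + c, z.2 = l%:R + d, 0 < c < 1, 0 < d < 1 &
        `|c - 2^-1| = `|d - 2^-1|].
Proof.
move=> [k [l [[_ [c c01 ->]]|[_ [c c01 ->]]]]] /=; exists k, l; rewrite -!natr1.
  by exists c, c; split=> //; ring.
exists c, (1 - c); split=> //; try by [ring|lra].
by rewrite distrC; congr `|_|; field.
Qed.

Lemma half_line_lt (R : realType) (k k' : nat) (c c' : R) (s s' : nat) :
  0 < c < 1 -> 0 < c' < 1 ->
  (`|c - 2^-1| < `|c' - 2^-1| -> (s < s')%N) ->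
  (`|c' - 2^-1| < `|c - 2^-1| -> (s' < s)%N) ->
  k%:R + c < k'%:R + c' ->
  line_lt (k.*2 + (2^-1 <= c)%R)%N s (k'.*2 + (2^-1 <= c')%R)%N s'.
Proof.
move=> c01 c'01 s_lt s_gt lt_x; rewrite /line_lt.
have [lt_k|lt_k|eq_k] := ltngtP k k'.
- by apply/orP; left; case: (_ <= c); case: (_ <= c'); lia.
- have : k'.+1%:R <= k%:R :> R by rewrite ler_nat.
  by rewrite -natr1; lra.
subst k'; have lt_c : c < c' by lra.
rewrite ltn_add2l eqn_add2l oddD odd_double /=.
case: (lerP 2^-1 c) s_lt s_gt => hc; case: (lerP 2^-1 c') => hc' //= s_lt s_gt; try lra.
- by apply: s_lt; lra.
- by apply: s_gt; lra.
Qed.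

(** Insert the points in increasing order of their distance to the centres of their
    cells.  Equal distances occur only between points that share neither half
    column nor half row, or lie in such a strip at equal coordinates, which is
    excluded; so ties may be broken arbitrarily. *)
Lemma Geom_word (R : realType) t u (M : 'M[int]_(t, u)) (p : permutation) :
  Geom R M p ->
  exists w : seq (quarter_cell t u), perm_of_word (@half_column t u) (@half_row t u) w = p.
Proof.
case: p => n p [/= z [/= fig_z lt_z inj_z pE]].
have /choice [k /choice [l /choice [c /choice [d zP]]]] :=
  fun i => standard_figure_coordinates (fig_z i).
pose dist i := `|c i - 2^-1|.
pose closer (i j : 'I_n) := (dist i < dist j) || ((dist i == dist j) && (i < j)%N).
have [time timeP] : exists time : 'S_n, forall i j, closer i j = (time i < time j)%N.
  apply: ranking_exists; rewrite /closer; split=> [i|j i h|i j ne_ij].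
  - by rewrite ltxx ltnn andbF.
  - case/orP=> [lt1|/andP[/eqP -> lt1]] /orP[lt2|/andP[/eqP e2 lt2]].
    + by rewrite (lt_trans lt1 lt2).
    + by rewrite -e2 lt1.
    + by rewrite lt2.
    + by rewrite e2 eqxx (ltn_trans lt1 lt2) orbT.
  - case: ltgtP => //= _; rewrite -neq_ltn; exact: ne_ij.
pose letter i : quarter_cell t u := ((k i, 2^-1 <= c i), (l i, 2^-1 <= d i)).
have time_inj : injective (fun i => time i : nat) by move=> i j /ord_inj/perm_inj.
have time_lt i j : dist i < dist j -> (time i < time j)%N.
  by rewrite -timeP /closer => ->.
have ltn_total : strict_total_order (fun i j : 'I_n => (i < j)%N).
  split=> [i|j i h|i j]; [exact: ltnn|exact: ltn_trans|by rewrite -neq_ltn].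
have p_total : strict_total_order (fun i j : 'I_n => (p i < p j)%N).
  split=> [i|j i h|i j]; [exact: ltnn|exact: ltn_trans|].
  by rewrite -neq_ltn -(inj_eq (@perm_inj _ p)).
have [|w [wp _ _]] := @gridding_word _ (@half_column t u) (@half_row t u) n p letter (fun i => time i).
  split=> //.
    apply: strict_total_eq => //; first exact: before_strict_total.
    move=> i j /lt_z; have [-> _ ci _ _] := zP i; have [-> _ cj _ _] := zP j.
    by apply: half_line_lt => // ?; apply: time_lt.
  apply: strict_total_eq => //; first exact: before_strict_total.
  move=> i j lt_p.
  have : (z i).2 < (z j).2.
    rewrite ltNge; apply: contraL lt_p => le_z; rewrite -leqNgt.
    rewrite -[X in (X <= _)%N]/(perm_entry (p := perm_of_length p) j).
    rewrite -[X in (_ <= X)%N]/(perm_entry (p := perm_of_length p) i) !pE.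
    by apply: subset_leq_card; apply/fintype.subsetP => h; rewrite !inE => /lt_le_trans; apply.
  have [_ -> _ di ei] := zP i; have [_ -> _ dj ej] := zP j.
  by apply: half_line_lt => //; rewrite -ei -ej => ?; apply: time_lt.
by exists w; rewrite perm_of_word_tuple wp.
Qed.

(** * The language of canonical words of a class *)

Theorem theorem8p1 (R : realType) (C : set permutation)
    (hclass : permutation_class C) (hgrid : geometrically_griddable R C) :
  (exists (A : finType) (L : set (seq A)) (f : seq A -> permutation),
     [/\ regular L,
         set_bij L C f &
         forall w, L w -> perm_length (f w) = size w]) /\
  rational_fps (generating_function C).
Proof.
have [t [u [M [_ C_geom]]]] := hgrid.
pose A := quarter_cell t u; pose f : seq A -> permutation :=
  perm_of_word (@half_column t u) (@half_row t u).
pose L : set (seq A) := [set w | C (f w)] `&` canonical (@half_column t u) (@half_row t u).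
have [d dP] : regular L.
  apply: recognizable_regular; apply: recognizableI; last exact: recognizable_canonical.
  by apply: subseq_closed_recognizable; apply: perm_class_words_subseq_closed.
have f_inj (w1 w2 : seq A) : L w1 -> L w2 -> f w1 = f w2 -> w1 = w2.
  move=> [_ can1] [_ can2] eq_f.
  have sz : size w2 == size w1 by apply/eqP/esym; exact: (congr1 perm_length eq_f).
  move: eq_f; rewrite /f -[w2]/(tval (Tuple sz)) perm_of_word_tuple => /perm_of_length_inj eq_p.
  have eq_w : in_tuple w1 = Tuple sz by apply: canonical_unique eq_p.
  exact: (congr1 (@tval _ _) eq_w).
have f_surj n (s : 'S_n) : C (perm_of_length s) ->
    exists2 w : n.-tuple A, L w & f w = perm_of_length s.
  move=> Cs; have [w0 w0s] := Geom_word (C_geom _ Cs).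
  have sz0 : size w0 == n by apply/eqP; exact: (congr1 perm_length w0s).
  have [w can_w wp] := canonical_exists (@half_column t u) (@half_row t u) (Tuple sz0).
  have fw : f w = perm_of_length s by rewrite /f perm_of_word_tuple wp -perm_of_word_tuple.
  by exists w => //; split=> //; rewrite /= fw.
split.
  exists A, L, f; split=> //; first by exists d.
  split=> [w []//|w1 w2|[n s]].
    by rewrite !inE; apply: f_inj.
  by move=> /f_surj [w Lw fw]; exists w.
apply: (eq_rational_fps _ (dfa_count_rational d)) => n; apply: (congr1 (fun m => m%:R : rat)).
pose g (w : n.-tuple A) := word_perm (@half_column t u) (@half_row t u) w.
have fg (w : n.-tuple A) : f w = perm_of_length (g w) by exact: perm_of_word_tuple.
have g_inj : {in [pred w : n.-tuple A | dfa_accept d w] &, injective g}.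
  move=> w1 w2; rewrite !inE => /dP L1 /dP L2 eq_g.
  by apply/val_inj/f_inj => //; rewrite !fg eq_g.
rewrite -(card_in_image g_inj); apply: eq_card => s; rewrite inE.
apply/asboolP/fintype.imageP => [/f_surj [w /dP Lw]|[w /dP [Cw _] ->]].
  by rewrite fg => /perm_of_length_inj <-; exists w.
by rewrite -fg.
Qed.
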